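(* Let $\Omega=V\bigwedge_{i=1}^n\big(dx_i+\sum_j\beta_{ij}dy_j\big)$ be the $n$-form on $X^\#$ determined by a symmetric matrix $\beta$ with $\mathrm{Im}\,\beta$ positive definite and $V=1/\sqrt{\det\mathrm{Im}\,\beta}$. Then $d\Omega=0$ if and only if the almost complex structure induced by $\Omega$ is integrable and $d\Omega\in F^2\Omega_X^{n+1}$.
   Context: $f^\#:X^\#\to B$ is a fibration of the form $X^\#=\mathcal{T}_B^*/\Lambda$, where $B$ is a real $n$-manifold and $\Lambda\subseteq\mathcal{T}_B^*$ is a closed, étale, Lagrangian family of discrete subgroups of the fibres; $X^\#$ carries the symplectic form $\omega$ induced by the standard one on $\mathcal{T}_B^*$ (this is the complement of the critical locus in an integral special Lagrangian fibration with Lagrangian section). Local coordinates $y_1,\dots,y_n$ on $B$ give canonical coordinates $y_1,\dots,y_n,x_1,\dots,x_n$ ($x_i$ fibre coordinates, representing the covector $\sum x_idy_i$), in which $\omega=\sum_idx_i\wedge dy_i$. $\beta=(\beta_{ij})$ is a complex-valued matrix of $C^\infty$ functions of $(x,y)$, given in each such coordinate system so that the local expressions define a global $C^\infty$ $n$-form $\Omega$ on $X^\#$. The almost complex structure induced by $\Omega$ is the one for which $\theta_i=dx_i+\sum_j\beta_{ij}dy_j$, $1\le i\le n$, span the $(1,0)$-forms. $F^p\Omega_X^{k}$ denotes the $k$-forms on $X^\#$ which locally are sums of terms each containing at least $p$ of the $dy_j$ (the filtration on forms induced by the subbundle $f^*\Omega_B^1\subseteq\Omega_X^1$). *)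

(* Defs.v *)
From mathcomp Require Import all_boot all_order all_algebra.
From mathcomp Require Import all_classical all_reals all_analysis.
From mathcomp Require Import complex.

Set Implicit Arguments.
Unset Strict Implicit.
Unset Printing Implicit Defensive.

Import Order.TTheory GRing.Theory Num.Theory.
Import numFieldNormedType.Exports.

Local Open Scope classical_set_scope.
Local Open Scope ring_scope.

Fixpoint Ck (R : realType) (m k : nat) (U : set 'rV[R]_m)
    (f : 'rV[R]_m -> R) : Prop :=
  if k is k'.+1 then
    (forall z, U z -> differentiable f z) /\
    (forall j : 'I_m, Ck k' U (fun z => 'D_(delta_mx 0 j) f z))
  else forall z, U z -> {for z, continuous f}.

Definition smooth (R : realType) (m : nat) (U : set 'rV[R]_m)
    (f : 'rV[R]_m -> R) : Prop := forall k, Ck k U f.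

Definition smooth_map (R : realType) (m p : nat) (U : set 'rV[R]_m)
    (h : 'rV[R]_m -> 'rV[R]_p) : Prop :=
  forall j : 'I_p, smooth U (fun z => h z 0 j).

Definition csmooth (R : realType) (m : nat) (U : set 'rV[R]_m)
    (f : 'rV[R]_m -> R[i]) : Prop :=
  smooth U (fun z => complex.Re (f z)) /\ smooth U (fun z => complex.Im (f z)).

(* Tangent vectors are row vectors.  A complex-valued k-form at a
   point is an alternating C-multilinear function of k complexified
   tangent vectors, given as the k rows of a matrix.
   Covectors are column vectors, a(v) being the entry of v *m a. *)

Definition cform (R : realType) (m k : nat) : Type :=
  'rV[R]_m -> 'M[R[i]]_(k, m) -> R[i].

Definition complexify (R : realType) (p q : nat) (A : 'M[R]_(p, q)) :
    'M[R[i]]_(p, q) := map_mx (real_complex R) A.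

Definition multilinear (K : comNzRingType) (k m : nat) (f : 'M[K]_(k, m) -> K) :
    Prop :=
  forall (A B C : 'M[K]_(k, m)) (i : 'I_k) (b c : K),
    row i A = b *: row i B + c *: row i C ->
    row' i B = row' i A -> row' i C = row' i A ->
    f A = b * f B + c * f C.

Definition alternate (K : comNzRingType) (k m : nat) (f : 'M[K]_(k, m) -> K) :
    Prop :=
  forall (A : 'M[K]_(k, m)) (i j : 'I_k),
    i != j -> row i A = row j A -> f A = 0.

(* a_0 /\ ... /\ a_(k-1), normalised so that it takes the value
   det (a_i (v_j)) on v_0, ..., v_(k-1). *)
Definition wedge (K : comNzRingType) (k m : nat) (a : 'I_k -> 'cV[K]_m)
    (M : 'M[K]_(k, m)) : K :=
  \det (\matrix_(i, j) (row j M *m a i) 0 0).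

Definition dcoord (K : comNzRingType) (m : nat) (j : 'I_m) : 'cV[K]_m :=
  delta_mx j 0.

Definition one_form (R : realType) (m : nat) (a : 'rV[R]_m -> 'cV[R[i]]_m) :
    cform R m 1 := fun z M => (M *m a z) 0 0.

Definition cpartial (R : realType) (m : nat) (j : 'I_m)
    (f : 'rV[R]_m -> R[i]) (z : 'rV[R]_m) : R[i] :=
  ('D_(delta_mx 0 j) (fun w => complex.Re (f w)) z +i*
   'D_(delta_mx 0 j) (fun w => complex.Im (f w)) z)%C.

Definition cderive (R : realType) (m : nat) (v : 'rV[R[i]]_m)
    (f : 'rV[R]_m -> R[i]) (z : 'rV[R]_m) : R[i] :=
  \sum_(j < m) v 0 j * cpartial j f z.

(* Exterior derivative: the usual invariant formula, evaluated on
   constant vector fields, whose brackets vanish. *)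
Definition ext_d (R : realType) (m k : nat) (eta : cform R m k) :
    cform R m k.+1 :=
  fun z M =>
    \sum_(i < k.+1)
      (-1) ^+ i * cderive (row i M) (fun w => eta w (row' i M)) z.

(* 'J h z is the library's Jacobian, acting on row vectors on the right. *)
Definition pullback (R : realType) (m p k : nat)
    (h : 'rV[R]_m -> 'rV[R]_p) (eta : cform R p k) : cform R m k :=
  fun z M => eta (h z) (M *m complexify ('J h z)).

(* The atlas need not be maximal, nor closed under orientation reversal. *)
Record manifold (R : realType) (n : nat) := Manifold {
  mspace :> topologicalType;
  mspace_hausdorff : hausdorff_space mspace;
  mspace_countable : @second_countable mspace;
  chart : Type;
  cdom : chart -> set mspace;
  coord : chart -> mspace -> 'rV[R]_n;
  param : chart -> 'rV[R]_n -> mspace;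
  cdom_open : forall c, open (cdom c);
  cdom_cover : forall b, exists c, cdom c b;
  crange_open : forall c, open (coord c @` cdom c);
  coordK : forall c b, cdom c b -> param c (coord c b) = b;
  coord_continuous : forall c, {within cdom c, continuous (coord c)};
  param_continuous : forall c, {within coord c @` cdom c, continuous (param c)};
  transition_smooth : forall c c',
    smooth_map (coord c @` (cdom c `&` cdom c')) (coord c' \o param c)
}.

Definition crange (R : realType) (n : nat) (B : manifold R n) (c : chart B) :
    set 'rV[R]_n := @coord _ _ B c @` cdom c.

Definition transition (R : realType) (n : nat) (B : manifold R n)
    (c c' : chart B) : 'rV[R]_n -> 'rV[R]_n := @coord _ _ B c' \o param c.

(* Canonical coordinates are z = row_mx y x, standing for the covector
   \sum_i x_i dy_i at the point with coordinates y.  The cotangent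
   bundle is the disjoint union of the sets phase c modulo
   same_covector. *)

Definition ypart (R : realType) (n : nat) (z : 'rV[R]_(n + n)) : 'rV[R]_n :=
  lsubmx z.

Definition xpart (R : realType) (n : nat) (z : 'rV[R]_(n + n)) : 'rV[R]_n :=
  rsubmx z.

Definition phase (R : realType) (n : nat) (B : manifold R n) (c : chart B) :
    set 'rV[R]_(n + n) := [set z | crange c (ypart z)].

(* Fibre coordinates with respect to the chart c of the covector with
   c'-coordinates x', at the point whose c-coordinates are y:
   x_j = \sum_i x'_i (d y'_i / d y_j). *)
Definition cochange (R : realType) (n : nat) (B : manifold R n)
    (c c' : chart B) (y x' : 'rV[R]_n) : 'rV[R]_n :=
  x' *m ('J (transition c c') y)^T.

Definition same_covector (R : realType) (n : nat) (B : manifold R n)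
    (c : chart B) (z : 'rV[R]_(n + n)) (c' : chart B) (z' : 'rV[R]_(n + n)) :
    Prop :=
  [/\ phase c z, phase c' z',
      param c (ypart z) = param c' (ypart z') &
      xpart z = cochange c c' (ypart z) (xpart z')].

(* The standard symplectic form \sum_i dx_i /\ dy_i. *)
Definition omega_std (R : realType) (n : nat) (u v : 'rV[R]_(n + n)) : R :=
  \sum_(i < n) (xpart u 0 i * ypart v 0 i - xpart v 0 i * ypart u 0 i).

Definition graph_map (R : realType) (n : nat) (lam : 'rV[R]_n -> 'rV[R]_n) :
    'rV[R]_n -> 'rV[R]_(n + n) := fun y => row_mx y (lam y).

(* A closed, etale, Lagrangian family of discrete subgroups of the fibres,
   as a subset of the cotangent bundle read in each chart. *)
Record lagrangian_family (R : realType) (n : nat) (B : manifold R n) :=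
  LagrangianFamily {
  lat :> chart B -> set 'rV[R]_(n + n);
  lat_phase : forall c, lat c `<=` phase c;
  lat_global : forall c z c' z',
    same_covector c z c' z' -> lat c z -> lat c' z';
  lat_zero : forall c y, crange c y -> lat c (row_mx y 0);
  lat_sub : forall c y x x',
    lat c (row_mx y x) -> lat c (row_mx y x') -> lat c (row_mx y (x - x'));
  lat_discrete : forall c y x,
    lat c (row_mx y x) -> isolated [set x' | lat c (row_mx y x')] x;
  lat_closed : forall c, closure (lat c) `&` phase c `<=` lat c;
  (* lat is locally the graph of a smooth section over an open subset of B *)
  lat_etale : forall c z, lat c z ->
    exists (W : set 'rV[R]_(n + n)) (U : set 'rV[R]_n)
           (lam : 'rV[R]_n -> 'rV[R]_n),
      [/\ open W /\ W z, open U /\ U `<=` crange c, smooth_map U lam &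
          lat c `&` W = graph_map lam @` U];
  lat_lagrangian : forall c (U : set 'rV[R]_n) (lam : 'rV[R]_n -> 'rV[R]_n),
    open U -> smooth_map U lam -> graph_map lam @` U `<=` lat c ->
    forall y, U y -> forall u v : 'rV[R]_n,
      omega_std (u *m 'J (graph_map lam) y) (v *m 'J (graph_map lam) y) = 0
}.

(* Each set phase c parametrises part of the quotient of the cotangent
   bundle by Lam by a local diffeomorphism, injective only modulo Lam;
   same_point says when two coordinate vectors represent the same point.
   Objects on the quotient are families of local expressions on the sets
   phase c that agree under every smooth local coordinate change
   (sharp_change); for c' = c these include the translations by local
   sections of Lam. *)

Definition same_point (R : realType) (n : nat) (B : manifold R n)
    (Lam : lagrangian_family B)
    (c : chart B) (z : 'rV[R]_(n + n)) (c' : chart B) (z' : 'rV[R]_(n + n)) :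
    Prop :=
  [/\ phase c z, phase c' z',
      param c (ypart z) = param c' (ypart z') &
      Lam c (row_mx (ypart z)
                    (xpart z - cochange c c' (ypart z) (xpart z')))].

Definition sharp_change (R : realType) (n : nat) (B : manifold R n)
    (Lam : lagrangian_family B) (c c' : chart B) (W : set 'rV[R]_(n + n))
    (h : 'rV[R]_(n + n) -> 'rV[R]_(n + n)) : Prop :=
  [/\ open W, smooth_map W h & forall z, W z -> same_point Lam c z c' (h z)].

(* Local expressions of a k-form, in all canonical coordinate systems. *)
Definition forms (R : realType) (n : nat) (B : manifold R n) (k : nat) : Type :=
  chart B -> cform R (n + n) k.

Definition is_form (R : realType) (n : nat) (B : manifold R n)
    (Lam : lagrangian_family B) (k : nat) (eta : forms B k) : Prop :=
  [/\ forall c z, phase c z -> multilinear (eta c z) /\ alternate (eta c z),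
      forall c M, csmooth (phase c) (fun z => eta c z M) &
      forall c c' W h, sharp_change Lam c c' W h ->
        forall z M, W z -> eta c z M = pullback h (eta c') z M].

Definition form_d (R : realType) (n : nat) (B : manifold R n) (k : nat)
    (eta : forms B k) : forms B k.+1 := fun c => ext_d (eta c).

Definition form_zero (R : realType) (n : nat) (B : manifold R n) (k : nat)
    (eta : forms B k) : Prop :=
  forall c z M, phase c z -> eta c z M = 0.

(* The coordinates y come first, so dz_l is some dy_j exactly when l < n. *)
Definition count_dy (n k : nat) (I : {ffun 'I_k -> 'I_(n + n)}) : nat :=
  #|[pred l : 'I_k | (I l < n)%N]|.

Definition in_filtration (R : realType) (n : nat) (B : manifold R n)
    (Lam : lagrangian_family B) (p k : nat) (eta : forms B k) : Prop :=
  is_form Lam eta /\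
  forall c z, phase c z ->
    exists (W : set 'rV[R]_(n + n))
           (g : {ffun 'I_k -> 'I_(n + n)} -> 'rV[R]_(n + n) -> R[i]),
      [/\ open W /\ W z, W `<=` phase c,
          forall I, csmooth W (g I) &
          forall w M, W w ->
            eta c w M = \sum_(I | (p <= count_dy I)%N)
                           g I w * wedge (fun l => dcoord R[i] (I l)) M].

(* Local expressions of an endomorphism field: v |-> v *m J c z. *)
Definition endos (R : realType) (n : nat) (B : manifold R n) : Type :=
  chart B -> 'rV[R]_(n + n) -> 'M[R]_(n + n).

Definition almost_complex (R : realType) (n : nat) (B : manifold R n)
    (Lam : lagrangian_family B) (J : endos B) : Prop :=
  [/\ forall c z, phase c z -> J c z *m J c z = - 1%:M,
      forall c i j, smooth (phase c) (fun z => J c z i j) &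
      forall c c' W h, sharp_change Lam c c' W h ->
        forall z, W z -> J c z *m 'J h z = 'J h z *m J c' (h z)].

(* a (J v) = i a(v) for all v *)
Definition covector10 (R : realType) (m : nat) (J : 'M[R]_m)
    (a : 'cV[R[i]]_m) : Prop := complexify J *m a = 'i%C *: a.

(* J v = - i v *)
Definition vector01 (R : realType) (m : nat) (J : 'M[R]_m)
    (v : 'rV[R[i]]_m) : Prop := v *m complexify J = - 'i%C *: v.

(* J is integrable when the exterior derivative of every local smooth
   (1,0)-form has vanishing (0,2)-part. *)
Definition integrable_acs (R : realType) (n : nat) (B : manifold R n)
    (J : endos B) : Prop :=
  forall c (W : set 'rV[R]_(n + n)) (a : 'rV[R]_(n + n) -> 'cV[R[i]]_(n + n)),
    open W -> W `<=` phase c ->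
    (forall j, csmooth W (fun z => a z j 0)) ->
    (forall z, W z -> covector10 (J c z) (a z)) ->
    forall z, W z -> forall u v : 'rV[R[i]]_(n + n),
      vector01 (J c z) u -> vector01 (J c z) v ->
      ext_d (one_form a) z (col_mx u v) = 0.

Definition dy (K : comNzRingType) (n : nat) (j : 'I_n) : 'cV[K]_(n + n) :=
  dcoord K (lshift n j).

Definition dx (K : comNzRingType) (n : nat) (i : 'I_n) : 'cV[K]_(n + n) :=
  dcoord K (rshift n i).

Definition theta (K : comNzRingType) (n : nat) (beta : 'M[K]_n) (i : 'I_n) :
    'cV[K]_(n + n) := dx K i + \sum_(j < n) beta i j *: dy K j.

Definition betas (R : realType) (n : nat) (B : manifold R n) : Type :=
  chart B -> 'rV[R]_(n + n) -> 'M[R[i]]_n.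

Definition mx_Im (R : realType) (n : nat) (A : 'M[R[i]]_n) : 'M[R]_n :=
  map_mx (@complex.Im R) A.

Definition posdef (R : realType) (n : nat) (A : 'M[R]_n) : Prop :=
  A^T = A /\ forall v : 'rV[R]_n, v != 0 -> 0 < (v *m A *m v^T) 0 0.

Definition Vol (R : realType) (n : nat) (A : 'M[R[i]]_n) : R :=
  (Num.sqrt (\det (mx_Im A)))^-1.

Definition Omega (R : realType) (n : nat) (B : manifold R n) (beta : betas B) :
    forms B n :=
  fun c z M => (Vol (beta c z))%:C%C * wedge (theta (beta c z)) M.

(* The almost complex structure induced by Omega: the theta_i span the
   (1,0)-forms at every point. *)
Definition induced_acs (R : realType) (n : nat) (B : manifold R n)
    (beta : betas B) (J : endos B) : Prop :=
  forall c z, phase c z -> forall a : 'cV[R[i]]_(n + n),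
    covector10 (J c z) a <->
    exists k : 'I_n -> R[i], a = \sum_(i < n) k i *: theta (beta c z) i.

(* Main.v *)
(* Let u, v be tangent vectors at z killed by all the theta_i, i.e. of type
   (0,1). Expanding the determinant Omega(..., u, ...) along the row of u,
   whose entries theta_i(u) vanish at z, Leibniz' rule gives
     dOmega(u, v, w_2, ..., w_n)
       = V det (dtheta_i(u, v), theta_i(w_2), ..., theta_i(w_n))_i,
   in which no derivative of V occurs. So dOmega = 0 forces dtheta_i(u, v) = 0
   (take coordinate vectors d/dx_a for the w), which is integrability.
   Conversely integrability makes dOmega vanish as soon as two of its arguments
   are of type (0,1); the tangent space is spanned by vertical and
   (0,1)-vectors, and the F^2 condition kills dOmega when at most one argument
   is not vertical. *)
Require Import Defs.
From mathcomp Require Import all_boot all_order all_algebra.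
From mathcomp Require Import all_classical all_reals all_analysis.
From mathcomp Require Import complex.
From mathcomp Require Import ring.

Set Implicit Arguments.
Unset Strict Implicit.
Unset Printing Implicit Defensive.

Import Order.TTheory GRing.Theory Num.Theory.
Import numFieldNormedType.Exports.

Local Open Scope ring_scope.

(** * Differentiation of complex-valued functions of real variables *)

Definition cdifferentiable (R : realType) (m : nat) (f : 'rV[R]_m -> R[i])
    (z : 'rV[R]_m) : Prop :=
  differentiable (fun w => complex.Re (f w)) z /\
  differentiable (fun w => complex.Im (f w)) z.

Lemma csmooth_differentiable (R : realType) (m : nat) (U : set 'rV[R]_m)
    (f : 'rV[R]_m -> R[i]) (z : 'rV[R]_m) :
  csmooth U f -> U z -> cdifferentiable f z.
Proof.
by move=> [/(_ 1%N)[dRe _] /(_ 1%N)[dIm _]] Uz; split; [apply: dRe|apply: dIm].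
Qed.

Lemma cdifferentiable_cst (R : realType) (m : nat) (a : R[i]) (z : 'rV[R]_m) :
  cdifferentiable (fun=> a) z.
Proof. by split; apply: differentiable_cst. Qed.

Lemma cdifferentiableD (R : realType) (m : nat) (f g : 'rV[R]_m -> R[i])
    (z : 'rV[R]_m) :
  cdifferentiable f z -> cdifferentiable g z ->
  cdifferentiable (fun w => f w + g w) z.
Proof.
move=> [fR fI] [gR gI]; split.
  rewrite (_ : (fun w => _) =
    (fun w => complex.Re (f w)) + (fun w => complex.Re (g w))).
    exact: differentiableD.
  by apply/funext => w /=; rewrite fctE; case: (f w) (g w) => ? ? [].
rewrite (_ : (fun w => _) =
  (fun w => complex.Im (f w)) + (fun w => complex.Im (g w))).
  exact: differentiableD.
by apply/funext => w /=; rewrite fctE; case: (f w) (g w) => ? ? [].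
Qed.

Lemma ReM_fun (R : realType) (T : Type) (f g : T -> R[i]) :
  (fun w => complex.Re (f w * g w)) =
  (fun w => complex.Re (f w)) * (fun w => complex.Re (g w)) -
  (fun w => complex.Im (f w)) * (fun w => complex.Im (g w)).
Proof. by apply/funext => w /=; rewrite !fctE; case: (f w) (g w) => ? ? []. Qed.

Lemma ImM_fun (R : realType) (T : Type) (f g : T -> R[i]) :
  (fun w => complex.Im (f w * g w)) =
  (fun w => complex.Re (f w)) * (fun w => complex.Im (g w)) +
  (fun w => complex.Im (f w)) * (fun w => complex.Re (g w)).
Proof. by apply/funext => w /=; rewrite !fctE; case: (f w) (g w) => ? ? []. Qed.

Lemma cdifferentiableM (R : realType) (m : nat) (f g : 'rV[R]_m -> R[i])
    (z : 'rV[R]_m) :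
  cdifferentiable f z -> cdifferentiable g z ->
  cdifferentiable (fun w => f w * g w) z.
Proof.
move=> [fR fI] [gR gI]; split.
  by rewrite ReM_fun; apply: differentiableB; apply: differentiableM.
by rewrite ImM_fun; apply: differentiableD; apply: differentiableM.
Qed.

Lemma cdifferentiable_sum (R : realType) (m : nat) (I : Type) (r : seq I)
    (F : I -> 'rV[R]_m -> R[i]) (z : 'rV[R]_m) :
  (forall i, cdifferentiable (F i) z) ->
  cdifferentiable (fun w => \sum_(i <- r) F i w) z.
Proof.
move=> dF; elim: r => [|i r IH].
  under eq_fun do rewrite big_nil; exact: cdifferentiable_cst.
under eq_fun do rewrite big_cons; exact: cdifferentiableD.
Qed.

Lemma cpartialD (R : realType) (m : nat) (j : 'I_m) (f g : 'rV[R]_m -> R[i])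
    (z : 'rV[R]_m) :
  cdifferentiable f z -> cdifferentiable g z ->
  cpartial j (fun w => f w + g w) z = cpartial j f z + cpartial j g z.
Proof.
move=> [fR fI] [gR gI]; rewrite /cpartial.
rewrite (_ : (fun w => complex.Re _) =
    (fun w => complex.Re (f w)) + (fun w => complex.Re (g w))); last first.
  by apply/funext => w /=; rewrite fctE; case: (f w) (g w) => ? ? [].
rewrite (_ : (fun w => complex.Im _) =
    (fun w => complex.Im (f w)) + (fun w => complex.Im (g w))); last first.
  by apply/funext => w /=; rewrite fctE; case: (f w) (g w) => ? ? [].
by rewrite !deriveD //; apply: diff_derivable.
Qed.

Lemma cpartialM (R : realType) (m : nat) (j : 'I_m) (f g : 'rV[R]_m -> R[i])
    (z : 'rV[R]_m) :
  cdifferentiable f z -> cdifferentiable g z ->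
  cpartial j (fun w => f w * g w) z =
  cpartial j f z * g z + f z * cpartial j g z.
Proof.
move=> [fR fI] [gR gI]; rewrite /cpartial ReM_fun ImM_fun.
rewrite deriveB ?deriveD ?deriveM //;
  do ?[by apply: diff_derivable | by apply: derivableM; apply: diff_derivable].
case: (f z) (g z) => a b [c d].
do 4!move: ('D_(delta_mx 0 j) _ z) => ?.
by congr (_ +i* _)%C; rewrite /GRing.scale /=; ring.
Qed.

Lemma cpartial_cst (R : realType) (m : nat) (j : 'I_m) (a : R[i])
    (z : 'rV[R]_m) : cpartial j (fun=> a) z = 0.
Proof. by rewrite /cpartial !derive_cst. Qed.

Lemma eq_near_cpartial (R : realType) (m : nat) (j : 'I_m)
    (f g : 'rV[R]_m -> R[i]) (z : 'rV[R]_m) :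
  (\forall w \near z, f w = g w) -> cpartial j f z = cpartial j g z.
Proof.
move=> fg; rewrite /cpartial; congr (_ +i* _)%C; apply: near_eq_derive;
  by apply: filterS fg => w ->.
Qed.

Lemma eq_near_cderive (R : realType) (m : nat) (v : 'rV[R[i]]_m)
    (f g : 'rV[R]_m -> R[i]) (z : 'rV[R]_m) :
  (\forall w \near z, f w = g w) -> cderive v f z = cderive v g z.
Proof.
by move=> fg; apply: eq_bigr => j _; rewrite (eq_near_cpartial j fg).
Qed.

Lemma cderive_cst (R : realType) (m : nat) (v : 'rV[R[i]]_m) (a : R[i])
    (z : 'rV[R]_m) : cderive v (fun=> a) z = 0.
Proof. by rewrite /cderive big1 // => j _; rewrite cpartial_cst mulr0. Qed.

Lemma cderiveD (R : realType) (m : nat) (v : 'rV[R[i]]_m)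
    (f g : 'rV[R]_m -> R[i]) (z : 'rV[R]_m) :
  cdifferentiable f z -> cdifferentiable g z ->
  cderive v (fun w => f w + g w) z = cderive v f z + cderive v g z.
Proof.
move=> df dg; rewrite /cderive -big_split /=; apply: eq_bigr => j _.
by rewrite cpartialD // mulrDr.
Qed.

Lemma cderiveM (R : realType) (m : nat) (v : 'rV[R[i]]_m)
    (f g : 'rV[R]_m -> R[i]) (z : 'rV[R]_m) :
  cdifferentiable f z -> cdifferentiable g z ->
  cderive v (fun w => f w * g w) z =
  cderive v f z * g z + f z * cderive v g z.
Proof.
move=> df dg; rewrite /cderive mulr_suml mulr_sumr -big_split /=.
by apply: eq_bigr => j _; rewrite cpartialM //; ring.
Qed.

Lemma cderiveZ (R : realType) (m : nat) (v : 'rV[R[i]]_m) (a : R[i])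
    (f : 'rV[R]_m -> R[i]) (z : 'rV[R]_m) :
  cdifferentiable f z ->
  cderive v (fun w => a * f w) z = a * cderive v f z.
Proof.
move=> df; rewrite (cderiveM _ (cdifferentiable_cst a z) df) cderive_cst.
by rewrite mul0r add0r.
Qed.

Lemma cderive_sum (R : realType) (m : nat) (v : 'rV[R[i]]_m) (I : Type)
    (r : seq I) (F : I -> 'rV[R]_m -> R[i]) (z : 'rV[R]_m) :
  (forall i, cdifferentiable (F i) z) ->
  cderive v (fun w => \sum_(i <- r) F i w) z = \sum_(i <- r) cderive v (F i) z.
Proof.
move=> dF; elim: r => [|i r IH].
  under eq_fun do rewrite big_nil; by rewrite big_nil cderive_cst.
under eq_fun do rewrite big_cons.
by rewrite big_cons cderiveD ?IH //; apply: cdifferentiable_sum.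
Qed.

Lemma cderive_linear (R : realType) (m : nat) (b c : R[i])
    (u v : 'rV[R[i]]_m) (f : 'rV[R]_m -> R[i]) (z : 'rV[R]_m) :
  cderive (b *: u + c *: v) f z = b * cderive u f z + c * cderive v f z.
Proof.
rewrite /cderive !mulr_sumr -big_split /=; apply: eq_bigr => j _.
by rewrite !mxE; ring.
Qed.

(** In Leibniz' rule the derivatives of [g i] carry the factor [f i z = 0]. The volume factor will
    sit in [g i]. *)
Lemma cderive_sum_zero (R : realType) (m n : nat) (v : 'rV[R[i]]_m)
    (f g : 'I_n -> 'rV[R]_m -> R[i]) (z : 'rV[R]_m) :
  (forall i, cdifferentiable (f i) z) -> (forall i, cdifferentiable (g i) z) ->
  (forall i, f i z = 0) ->
  cderive v (fun w => \sum_i f i w * g i w) z =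
  \sum_i cderive v (f i) z * g i z.
Proof.
move=> df dg f0; rewrite cderive_sum => [|i]; last exact: cdifferentiableM.
by apply: eq_bigr => i _; rewrite cderiveM // f0 mul0r addr0.
Qed.

(** * Smoothness of constants and of functions vanishing on an open set *)

Lemma near0_differentiable (R : numFieldType) (V W : normedModType R)
    (f : V -> W) (z : V) :
  (\forall w \near z, f w = 0) -> differentiable f z.
Proof.
move=> f0.
have eqf : f \o shift z = cst (f z) + (\0 : {linear V -> W}) +o_ 0 id.
  apply/eqaddoP => e e0; rewrite (nbhs_singleton f0).
  have : \forall w \near (0 : V), f (w + z) = 0.
    by have := f0; rewrite (near_shift 0 z) subr0.
  apply: filterS => w fw.
  by rewrite !fctE /= fw addr0 subr0 normr0 mulr_ge0 // ltW.
have c0 : continuous (\0 : {linear V -> W}) by move=> ?; exact: cst_continuous.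
by apply/diff_locallyP; rewrite (diff_unique c0 eqf).
Qed.

(** [f] is arbitrary outside [U]; openness makes it vanish near each point of [U], so its partial
    derivatives vanish on [U] too and induction applies. *)
Lemma zero_Ck (R : realType) (m k : nat) (U : set 'rV[R]_m)
    (f : 'rV[R]_m -> R) :
  open U -> (forall z, U z -> f z = 0) -> Ck k U f.
Proof.
move=> oU; elim: k f => [|k IH] f f0.
  move=> z Uz; apply: differentiable_continuous; apply: near0_differentiable.
  by apply: filterS (open_nbhs_nbhs (conj oU Uz)).
have nf0 z : U z -> \forall w \near z, f w = 0.
  by move=> Uz; apply: filterS (open_nbhs_nbhs (conj oU Uz)).
split=> [z Uz|j]; first exact: near0_differentiable (nf0 z Uz).
apply: IH => z Uz; rewrite (near_eq_derive (g := cst 0)) ?derive_cst //.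
exact: nf0.
Qed.

Lemma zero_csmooth (R : realType) (m : nat) (U : set 'rV[R]_m)
    (f : 'rV[R]_m -> R[i]) :
  open U -> (forall z, U z -> f z = 0) -> csmooth U f.
Proof. by move=> oU f0; split=> k; apply: zero_Ck => // z /f0 ->. Qed.

Lemma cst_csmooth (R : realType) (m : nat) (U : set 'rV[R]_m) (a : R[i]) :
  open U -> csmooth U (fun=> a).
Proof.
have sm (b : R) k : open U -> Ck k U (fun=> b).
  case: k => [|k] oU; first by move=> z _; apply: cst_continuous.
  split=> [z _|j]; first exact: differentiable_cst.
  by apply: zero_Ck => // z _; apply: derive_cst.
by move=> oU; split=> k; apply: sm.
Qed.

(** * Positivity of the determinant of a positive definite matrix *)

Lemma posdef_det_neq0 (R : realType) (n : nat) (A : 'M[R]_n) :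
  posdef A -> \det A != 0.
Proof.
move=> [_ pA]; apply/negP => /det0P[v v0 vA].
by have := pA v v0; rewrite vA mul0mx mxE ltxx.
Qed.

(* The segment from the identity to [A] stays in the convex set of positive
   definite matrices, so the determinant cannot change sign along it. *)
Lemma posdef_det_gt0 (R : realType) (n : nat) (A : 'M[R]_n) :
  posdef A -> 0 < \det A.
Proof.
move=> pA; rewrite ltNge; apply/negP => dA.
pose p : {poly R} := \det (map_mx polyC (A - 1%:M) *m ('X)%:M + 1%:M).
have pE t : p.[t] = \det (t *: A + (1 - t) *: 1%:M).
  rewrite -horner_evalE -det_map_mx; congr (\det _); apply/matrixP => i j.
  rewrite mul_mx_scalar !mxE /= /horner_eval.
  by rewrite hornerD hornerM hornerX hornerC -polyC_natr hornerC mulrBl; ring.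
(* [p] is 1 at 0 and [\det A <= 0] at 1, whereas [poly_ivt] expects a passage from nonpositive to
   nonnegative values, whence [- p]. *)
have [t /andP[t0 t1] /rootP pt] : exists2 t, 0 <= t <= 1 & root (- p) t.
  apply: poly_ivt => //; rewrite !hornerN !pE.
  rewrite scale0r add0r subr0 scale1r det1 scale1r subrr scale0r addr0.
  by rewrite oppr_le0 ler01 oppr_ge0.
have : posdef (t *: A + (1 - t) *: 1%:M).
  have [sA qA] := pA; split=> [|v v0].
    by rewrite linearD !linearZ /= sA trmx1.
  have v2 : 0 < (v *m v^T) 0 0.
    rewrite mxE lt_neqAle eq_sym psumr_neq0; last first.
      by move=> i _; rewrite !mxE -expr2 sqr_ge0.
    rewrite sumr_ge0 ?andbT; last by move=> i _; rewrite !mxE -expr2 sqr_ge0.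
    have /rV0Pn[i vi] := v0; apply/hasP; exists i; first exact: mem_index_enum.
    by rewrite !mxE -expr2 exprn_even_gt0.
  rewrite mulmxDr mulmxDl -!scalemxAr -!scalemxAl mulmx1.
  rewrite [X in 0 < X]mxE [X in X + _]mxE [X in _ + X]mxE.
  (* For [t < 1] strictness comes from the identity summand, since [t] may be 0. *)
  have [->|tn1] := eqVneq t 1; first by rewrite mul1r subrr mul0r addr0 qA.
  have lt1 : 0 < 1 - t by rewrite subr_gt0 lt_neqAle tn1.
  by rewrite ltr_wpDl ?mulr_gt0 // mulr_ge0 // ltW // qA.
move/posdef_det_neq0; rewrite -pE.
by move: pt => /eqP; rewrite hornerN oppr_eq0 => ->.
Qed.

(** * Replacement of rows, determinants and multilinear functions *)

Definition setrow (K : Type) (k m : nat) (j : 'I_k) (u : 'rV[K]_m)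
    (M : 'M[K]_(k, m)) : 'M[K]_(k, m) :=
  \matrix_(i, l) if i == j then u 0 l else M i l.

Lemma row_setrow (K : Type) (k m : nat) (j : 'I_k) (u : 'rV[K]_m)
    (M : 'M[K]_(k, m)) : row j (setrow j u M) = u.
Proof. by apply/rowP => l; rewrite !mxE eqxx. Qed.

Lemma row_setrow_neq (K : Type) (k m : nat) (i j : 'I_k) (u : 'rV[K]_m)
    (M : 'M[K]_(k, m)) : i != j -> row i (setrow j u M) = row i M.
Proof. by move=> /negPf ij; apply/rowP => l; rewrite !mxE ij. Qed.

Lemma row'_setrow (K : Type) (k m : nat) (j : 'I_k) (u : 'rV[K]_m)
    (M : 'M[K]_(k, m)) : row' j (setrow j u M) = row' j M.
Proof. by apply/matrixP => i l; rewrite !mxE eq_sym (negPf (neq_lift j i)). Qed.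

Lemma setrow_id (K : Type) (k m : nat) (j : 'I_k) (M : 'M[K]_(k, m)) :
  setrow j (row j M) M = M.
Proof. by apply/matrixP => i l; rewrite !mxE; case: eqP => [->|]. Qed.

Lemma setrow_mul (K : comNzRingType) (k m p : nat) (j : 'I_k) (u : 'rV[K]_m)
    (M : 'M[K]_(k, m)) (A : 'M[K]_(m, p)) :
  setrow j u M *m A = setrow j (u *m A) (M *m A).
Proof.
apply/matrixP => i l; rewrite !mxE; case: eqP => ij.
  by apply: eq_bigr => q _; rewrite !mxE ij eqxx.
by apply: eq_bigr => q _; rewrite !mxE; case: eqP.
Qed.

Lemma det_setrow_delta (K : comNzRingType) (n : nat) (j a : 'I_n)
    (N : 'M[K]_n) : \det (setrow j (delta_mx 0 a) N) = cofactor N j a.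
Proof.
rewrite (expand_det_row _ j) (bigD1 a) //= big1 => [|l la].
  rewrite !mxE !eqxx mul1r addr0 /cofactor; congr (_ * \det _).
  by apply/matrixP => p q; rewrite !mxE eq_sym (negPf (neq_lift j p)).
by rewrite !mxE !eqxx (negPf la) mul0r.
Qed.

(* Both sides are the terms of the expansion, along a first column supported
   in rows [i] and [i'], of a determinant whose rows [i] and [i'] agree. *)
Lemma det_setrow_exchange (K : comNzRingType) (n : nat) (i i' : 'I_n.+1)
    (j j' : 'I_n) (d : 'rV[K]_n) (N : 'M[K]_(n.+1, n)) :
  lift i j = i' -> lift i' j' = i ->
  (-1) ^+ i * \det (setrow j d (row' i N)) =
  - ((-1) ^+ i' * \det (setrow j' d (row' i' N))).
Proof.
move=> ij i'j'.
have neq_ii' : i != i' by rewrite -ij neq_lift.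
pose N' : 'M[K]_(n.+1, n) :=
  \matrix_(l, q) if (l == i) || (l == i') then d 0 q else N l q.
pose c : 'cV[K]_n.+1 := \col_l ((l == i) || (l == i'))%:R.
pose A : 'M[K]_(n.+1, 1 + n) := row_mx c N'.
pose j0 : 'I_(1 + n) := lshift n (0 : 'I_1).
have detA : \det A = 0.
  apply: (determinant_alternate neq_ii') => q; rewrite !mxE.
  by case: splitP => q' _; rewrite !mxE !eqxx orbT.
have cof_A l : cofactor A l j0 = (-1) ^+ l * \det (row' l N').
  rewrite /cofactor addn0; congr (_ * \det _); apply/matrixP => p q.
  rewrite !mxE (_ : lift j0 q = rshift 1 q :> 'I_(1 + n)); last exact/val_inj.
  by rewrite (unsplitK (inr q)) !mxE.
(* One copy of [d] remains, in row [i'] of [N'], which becomes row [j] once row [i] is deleted. *)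
have row'i : row' i N' = setrow j d (row' i N).
  apply/matrixP => p q; rewrite !mxE eq_sym (negPf (neq_lift _ _)) -ij.
  by rewrite (inj_eq lift_inj).
have row'i' : row' i' N' = setrow j' d (row' i' N).
  apply/matrixP => p q; rewrite !mxE orbC eq_sym (negPf (neq_lift _ _)) -i'j'.
  by rewrite (inj_eq lift_inj).
move: detA; rewrite (expand_det_col _ j0) (bigD1 i) //=.
rewrite (bigD1 i') 1?eq_sym //= big1 => [|l /andP[/negPf li /negPf li']].
  rewrite addr0 !row_mxEl !mxE !eqxx orbT !mul1r !cof_A row'i row'i'.
  by move/eqP; rewrite addr_eq0 => /eqP.
by rewrite row_mxEl mxE li li' mul0r.
Qed.

(** Splitting one row after another reduces the claim to matrices all of whose rows satisfy [P].
    Later [P] means vertical or of type (0,1). *)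
Lemma multilinear_eq0 (K : comNzRingType) (k m : nat) (f : 'M[K]_(k, m) -> K)
    (P : 'rV[K]_m -> Prop) :
  multilinear f ->
  (forall u, exists u1 u2, [/\ u = u1 + u2, P u1 & P u2]) ->
  (forall M, (forall i, P (row i M)) -> f M = 0) ->
  forall M, f M = 0.
Proof.
move=> mf Pdec f0 M.
(* Induction on the number [s] of leading rows still unrestricted; [s = k] imposes no condition on
   [N]. *)
have step s : (s <= k)%N ->
    forall N, (forall i : 'I_k, (s <= i)%N -> P (row i N)) -> f N = 0.
  elim: s => [|s IH] sk N PN; first by apply: f0 => i; apply: PN.
  pose i0 := Ordinal sk.
  have [u1 [u2 [uE P1 P2]]] := Pdec (row i0 N).
  have splitN :
      row i0 N = 1 *: row i0 (setrow i0 u1 N) + 1 *: row i0 (setrow i0 u2 N).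
    by rewrite !row_setrow !scale1r.
  rewrite (mf _ _ _ _ _ _ splitN) ?row'_setrow //.
  have P_setrow u : P u ->
      forall i : 'I_k, (s <= i)%N -> P (row i (setrow i0 u N)).
    move=> Pu i si; have [->|ii0] := eqVneq i i0; first by rewrite row_setrow.
    rewrite row_setrow_neq //; apply: PN.
    rewrite ltn_neqAle si andbT eq_sym.
    by apply: contraNneq ii0 => E; apply/eqP/val_inj.
  by rewrite !(IH (ltnW sk)) ?mulr0 ?addr0 //; apply: P_setrow.
by apply: (step k) => // i; rewrite leqNgt ltn_ord.
Qed.

(** * The exterior derivative *)

Lemma row_row' (K : Type) (k m : nat) (i : 'I_k) (j : 'I_k.-1)
    (M : 'M[K]_(k, m)) : row j (row' i M) = row (lift i j) M.
Proof. by apply/rowP => l; rewrite !mxE. Qed.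

(** The term differentiating along row [r] is linear in it through [cderive]. In the others row [r]
    is an argument of [eta], whose multilinearity is used under the derivative, hence near [z]. *)
Lemma multilinear_ext_d (R : realType) (m k : nat) (eta : cform R m k)
    (z : 'rV[R]_m) :
  (\forall w \near z, multilinear (eta w)) ->
  (forall M, cdifferentiable (fun w => eta w M) z) ->
  multilinear (ext_d eta z).
Proof.
move=> meta deta A B C r b c rA rB rC; rewrite /ext_d !mulr_sumr -big_split /=.
apply: eq_bigr => i _; have [->|ir] := eqVneq i r.
  by rewrite rA rB rC cderive_linear; ring.
have /unlift_some[s rE _] : i != r by [].
have rowi D : row' r D = row' r A -> row i D = row i A.
  move=> rD; have /unlift_some[p pE _] : r != i by rewrite eq_sym.
  by rewrite pE -!row_row' rD.
rewrite (rowi B rB) (rowi C rC).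
have row's D : row' r D = row' r A -> row' s (row' i D) = row' s (row' i A).
  move=> rD; apply/row_matrixP => p; rewrite !row_row'.
  have /unlift_some[q qE _] : r != lift i (lift s p).
    by rewrite rE (inj_eq lift_inj) neq_lift.
  by rewrite qE -!row_row' rD.
rewrite -[b * (_ * _)]mulrCA -[c * (_ * _)]mulrCA -mulrDr; congr (_ * _).
rewrite -!cderiveZ // -cderiveD; first last.
- by apply: cdifferentiableM => //; apply: cdifferentiable_cst.
- by apply: cdifferentiableM => //; apply: cdifferentiable_cst.
apply: eq_near_cderive; apply: filterS meta => w mw.
by apply: (mw _ _ _ s);
  [rewrite !(row_row' i s) -rE | exact: row's | exact: row's].
Qed.

Lemma ext_d_one_form (R : realType) (m : nat) (a : 'rV[R]_m -> 'cV[R[i]]_m)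
    (z : 'rV[R]_m) (u v : 'rV[R[i]]_m) :
  ext_d (one_form a) z (col_mx u v) =
  cderive u (fun w => (v *m a w) 0 0) z - cderive v (fun w => (u *m a w) 0 0) z.
Proof.
pose M : 'M[R[i]]_(1 + 1, m) := col_mx u v.
have r0 : row (ord0 : 'I_2) M = u.
  by apply/rowP => l; rewrite !mxE; case: splitP => // q _; rewrite ord1.
have r1 : row (lift ord0 ord0 : 'I_2) M = v.
  by apply/rowP => l; rewrite !mxE; case: splitP => [[[]]|q _] //; rewrite ord1.
have r'0 : row' (ord0 : 'I_2) M = v.
  by apply/row_matrixP => p; rewrite row_row' [p]ord1 row_id; exact: r1.
have r'1 : row' (lift ord0 ord0 : 'I_2) M = u.
  apply/row_matrixP => p; rewrite row_row' [p]ord1 row_id.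
  by rewrite (_ : lift _ _ = ord0) ?r0 //; apply/val_inj.
rewrite /ext_d big_ord_recl big_ord1 -/M r0 r1 r'0 r'1.
by rewrite expr0 mul1r expr1 mulN1r.
Qed.

(** * Omega and its exterior derivative in one canonical coordinate system *)

(** The columns are the theta_i, so [u *m thetamx beta] lists their values on [u]; it will vanish
    exactly for [u] of type (0,1). *)
Definition thetamx (K : comNzRingType) (n : nat) (beta : 'M[K]_n) :
    'M[K]_(n + n, n) := col_mx beta^T 1%:M.

Lemma col_thetamx (K : comNzRingType) (n : nat) (beta : 'M[K]_n) (i : 'I_n) :
  col i (thetamx beta) = theta beta i.
Proof.
apply/colP => l; rewrite /theta !mxE summxE.
case: splitP => q qE.
  rewrite (_ : l = lshift n q); last exact/val_inj.
  rewrite !mxE eq_lrshift /= add0r (bigD1 q) //= !mxE !eqxx mulr1.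
  rewrite big1 ?addr0 //.
  by move=> p /negPf pq; rewrite !mxE (inj_eq (@lshift_inj _ _)) eq_sym pq mulr0.
rewrite (_ : l = rshift n q); last exact/val_inj.
rewrite !mxE (inj_eq (@rshift_inj _ _)) andbT big1 ?addr0 // => p _.
by rewrite !mxE eq_rlshift mulr0.
Qed.

Lemma mul_theta (K : comNzRingType) (n k : nat) (beta : 'M[K]_n) (i : 'I_n)
    (M : 'M[K]_(k, n + n)) (j : 'I_k) :
  (row j M *m theta beta i) 0 0 = (M *m thetamx beta) j i.
Proof. by rewrite -col_thetamx !mxE; apply: eq_bigr => l _; rewrite !mxE. Qed.

Lemma mul_theta_row (K : comNzRingType) (n : nat) (beta : 'M[K]_n) (i : 'I_n)
    (u : 'rV[K]_(n + n)) :
  (u *m theta beta i) 0 0 = (u *m thetamx beta) 0 i.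
Proof. by rewrite -mul_theta row_id. Qed.

Lemma mul_thetaE (K : comNzRingType) (n : nat) (beta : 'M[K]_n) (i : 'I_n)
    (u : 'rV[K]_(n + n)) :
  (u *m theta beta i) 0 0 =
  \sum_j beta i j * u 0 (lshift n j) + u 0 (rshift n i).
Proof.
rewrite mul_theta_row -{1}[u]hsubmxK /thetamx mul_row_col mulmx1 !mxE.
by congr (_ + _); apply: eq_bigr => j _; rewrite !mxE mulrC.
Qed.

Lemma wedge_theta (K : comNzRingType) (n : nat) (beta : 'M[K]_n)
    (M : 'M[K]_(n, n + n)) : wedge (theta beta) M = \det (M *m thetamx beta).
Proof.
rewrite -det_tr; congr (\det _); apply/matrixP => i j.
by rewrite [LHS]mxE [RHS]mxE mul_theta.
Qed.

(** The vertical vectors d/dx_a; they are dual to the theta_i whatever [beta] is. *)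
Definition ddx (K : comNzRingType) (n : nat) (a : 'I_n) : 'rV[K]_(n + n) :=
  row_mx 0 (delta_mx 0 a).

Lemma ddx_theta (K : comNzRingType) (n : nat) (beta : 'M[K]_n) (a : 'I_n) :
  ddx K a *m thetamx beta = delta_mx 0 a.
Proof. by rewrite mul_row_col mul0mx add0r mulmx1. Qed.

(** [Omega beta c] is convertible to [local_Omega (beta c)], so the computation can forget the
    manifold. *)
Definition local_Omega (R : realType) (n : nat)
    (beta : 'rV[R]_(n + n) -> 'M[R[i]]_n) : cform R (n + n) n :=
  fun z M => (Vol (beta z))%:C%C * wedge (theta (beta z)) M.

(** Laplace expansion along row [j], each cofactor being the determinant with d/dx_a as argument
    number [j]. It holds at every point and so can be differentiated. *)
Lemma local_Omega_expand (R : realType) (n : nat)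
    (beta : 'rV[R]_(n + n) -> 'M[R[i]]_n) (z : 'rV[R]_(n + n)) (j : 'I_n)
    (N : 'M[R[i]]_(n, n + n)) :
  local_Omega beta z N =
  \sum_a (row j N *m theta (beta z) a) 0 0 *
         local_Omega beta z (setrow j (ddx _ a) N).
Proof.
rewrite /local_Omega wedge_theta (expand_det_row _ j) mulr_sumr.
apply: eq_bigr => a _; rewrite mul_theta wedge_theta setrow_mul ddx_theta.
by rewrite det_setrow_delta mulrCA.
Qed.

Lemma local_Omega_eq0 (R : realType) (n : nat)
    (beta : 'rV[R]_(n + n) -> 'M[R[i]]_n) (z : 'rV[R]_(n + n)) (j : 'I_n)
    (N : 'M[R[i]]_(n, n + n)) :
  row j N *m thetamx (beta z) = 0 -> local_Omega beta z N = 0.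
Proof.
move=> N0; rewrite (local_Omega_expand beta z j) big1 // => a _.
by rewrite mul_theta_row N0 mxE mul0r.
Qed.

Lemma cdifferentiable_theta (R : realType) (n : nat)
    (beta : 'rV[R]_(n + n) -> 'M[R[i]]_n) (z : 'rV[R]_(n + n))
    (u : 'rV[R[i]]_(n + n)) (a : 'I_n) :
  (forall i j, cdifferentiable (fun w => beta w i j) z) ->
  cdifferentiable (fun w => (u *m theta (beta w) a) 0 0) z.
Proof.
move=> db; under eq_fun do rewrite mul_thetaE.
apply: cdifferentiableD; last exact: cdifferentiable_cst.
by apply: cdifferentiable_sum => j; apply: cdifferentiableM.
Qed.

(** The coefficients theta_a of row [j] vanish at [z], so the other factor, which contains the
    volume, is never differentiated. *)
Lemma cderive_local_Omega (R : realType) (n : nat)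
    (beta : 'rV[R]_(n + n) -> 'M[R[i]]_n) (z : 'rV[R]_(n + n)) (j : 'I_n)
    (N : 'M[R[i]]_(n, n + n)) (v : 'rV[R[i]]_(n + n)) :
  (forall i j, cdifferentiable (fun w => beta w i j) z) ->
  (forall M, cdifferentiable (fun w => local_Omega beta w M) z) ->
  row j N *m thetamx (beta z) = 0 ->
  cderive v (fun w => local_Omega beta w N) z =
  \sum_a cderive v (fun w => (row j N *m theta (beta w) a) 0 0) z *
         local_Omega beta z (setrow j (ddx _ a) N).
Proof.
move=> db dO N0; under eq_fun do rewrite (local_Omega_expand beta _ j).
apply: cderive_sum_zero => // a; first exact: cdifferentiable_theta.
by rewrite mul_theta_row N0 mxE.
Qed.

(** Only the terms differentiating along rows [i] and [i'] survive, and they combine into values of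
    dtheta_a. The index [j] is the position of row [i'] once row [i] is removed. *)
Lemma ext_d_local_Omega (R : realType) (n : nat)
    (beta : 'rV[R]_(n + n) -> 'M[R[i]]_n) (z : 'rV[R]_(n + n)) (i i' : 'I_n.+1)
    (j : 'I_n) (M : 'M[R[i]]_(n.+1, n + n)) :
  (forall i j, cdifferentiable (fun w => beta w i j) z) ->
  (forall N, cdifferentiable (fun w => local_Omega beta w N) z) ->
  lift i j = i' ->
  row i M *m thetamx (beta z) = 0 -> row i' M *m thetamx (beta z) = 0 ->
  ext_d (local_Omega beta) z M =
  \sum_a ext_d (one_form (fun w => theta (beta w) a)) z
           (col_mx (row i M) (row i' M)) *
         ((-1) ^+ i * local_Omega beta z (setrow j (ddx _ a) (row' i M))).
Proof.
move=> db dO ij Mi Mi'.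
have neq_i'i : i' != i by rewrite -ij eq_sym neq_lift.
have /unlift_some[j' i'j' _] := neq_i'i.
rewrite [LHS]/ext_d (bigD1 i) //= (bigD1 i') //= big1 => [|l /andP[li li']];
    last first.
  (* Rows [i] and [i'] are both arguments here, at positions [p] and [p']. Differentiating the
     theta-values of the first leaves the second, which makes Omega vanish. *)
  have /unlift_some[p pE _] := li; have /unlift_some[p' p'E _] := li'.
  rewrite (cderive_local_Omega (j := p)) // ?row_row' -?pE //.
  rewrite big1 ?mulr0 // => a _.
  rewrite (local_Omega_eq0 (j := p')) ?mulr0 //.
  rewrite row_setrow_neq ?row_row' -?p'E //.
  by apply: contraNneq neq_i'i => E; rewrite p'E pE E.
have kerj : row j (row' i M) *m thetamx (beta z) = 0.
  by rewrite (row_row' i j) ij.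
have kerj' : row j' (row' i' M) *m thetamx (beta z) = 0.
  by rewrite (row_row' i' j') -i'j'.
rewrite [X in _ + X]addr0.
rewrite (cderive_local_Omega (row i M) db dO kerj).
rewrite (cderive_local_Omega (row i' M) db dO kerj').
rewrite (row_row' i j) (row_row' i' j') -i'j' ij.
rewrite !mulr_sumr -big_split /=; apply: eq_bigr => a _.
rewrite ext_d_one_form mulrBl; congr (_ + _); first by rewrite mulrCA.
(* The exchange of rows yields the minus sign in dtheta_a(u, v) = u(theta_a(v)) - v(theta_a(u)). *)
rewrite mulrCA -mulrN; congr (_ * _).
rewrite /local_Omega !wedge_theta !setrow_mul ddx_theta.
rewrite [LHS]mulrCA [in RHS]mulrCA -mulrN; congr (_ * _).
have row'_mul l : row' l M *m thetamx (beta z) = row' l (M *m thetamx (beta z)).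
  by apply/row_matrixP => p; rewrite row_mul !row_row' row_mul.
by rewrite !row'_mul (det_setrow_exchange _ _ ij (esym i'j')) opprK.
Qed.

(** * Vectors of type (0,1) as the common kernel of the theta_i *)

Lemma theta_span (K : comNzRingType) (n : nat) (beta : 'M[K]_n) (a : 'I_n) :
  exists k : 'I_n -> K, theta beta a = \sum_(i < n) k i *: theta beta i.
Proof.
exists (fun i => (i == a)%:R); rewrite (bigD1 a) //= eqxx scale1r.
by rewrite big1 ?addr0 // => i /negPf ->; rewrite scale0r.
Qed.

Lemma phase_open (R : realType) (n : nat) (B : manifold R n) (c : chart B) :
  open (phase c).
Proof.
apply: open_comp; last exact: crange_open.
by move=> z _; apply: differentiable_continuous; apply: differentiable_lsubmx.
Qed.

(** For [v] of type (0,1), computing theta_a(Jv) in two ways gives -i theta_a(v) = i theta_a(v).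
    Conversely J(J + i) = i(J + i), so the columns of J + i are combinations of the theta_i and v(J
    + i) = 0. *)
Lemma vector01P (R : realType) (n : nat) (beta : 'M[R[i]]_n) (J : 'M[R]_(n + n))
    (v : 'rV[R[i]]_(n + n)) :
  J *m J = - 1%:M ->
  (forall a, covector10 J a <->
     exists k : 'I_n -> R[i], a = \sum_(i < n) k i *: theta beta i) ->
  vector01 J v <-> v *m thetamx beta = 0.
Proof.
move=> JJ indJ; split=> [vJ|v0].
  apply/rowP => a; rewrite [RHS]mxE -mul_theta_row.
  have : covector10 J (theta beta a).
    exact/indJ/theta_span.
  move=> /(congr1 (fun x => (v *m x) 0 0)).
  rewrite mulmxA vJ -scalemxAl -scalemxAr !mxE mulNr => /eqP.
  rewrite eq_sym -subr_eq0 opprK -mulr2n mulrn_eq0 /= mulf_eq0.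
  by rewrite (negPf (neq0Ci _)) /= => /eqP.
apply/eqP; rewrite scaleNr -addr_eq0; apply/eqP.
pose K := complexify J + ('i%C)%:M.
have JK : complexify J *m K = 'i%C *: K.
  rewrite mulmxDr mul_mx_scalar -map_mxM JJ map_mxN map_mx1 scalerDr addrC.
  by rewrite scale_scalar_mx -expr2 sqr_i rmorphN.
have -> : v *m complexify J + 'i%C *: v = v *m K.
  by rewrite mulmxDr mul_mx_scalar.
apply/rowP => q; rewrite [RHS]mxE.
have /indJ[k kE] : covector10 J (col q K).
  by rewrite /covector10 colE mulmxA JK -scalemxAl.
have -> : (v *m K) 0 q = (v *m col q K) 0 0.
  by rewrite colE mulmxA -colE [RHS]mxE.
rewrite kE mulmx_sumr summxE big1 // => i _.
by rewrite -scalemxAr mxE mul_theta_row v0 mxE mulr0.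
Qed.

(** * From the vanishing of dOmega to integrability *)

(** On [u], [v] and the d/dx_b with b different from [a], dOmega takes the value V dtheta_a(u, v),
    and V is nonzero. *)
Lemma ext_d_theta_eq0 (R : realType) (n : nat)
    (beta : 'rV[R]_(n + n) -> 'M[R[i]]_n) (z : 'rV[R]_(n + n))
    (u v : 'rV[R[i]]_(n + n)) (a : 'I_n) :
  (forall i j, cdifferentiable (fun w => beta w i j) z) ->
  (forall N, cdifferentiable (fun w => local_Omega beta w N) z) ->
  posdef (mx_Im (beta z)) ->
  (forall M, ext_d (local_Omega beta) z M = 0) ->
  u *m thetamx (beta z) = 0 -> v *m thetamx (beta z) = 0 ->
  ext_d (one_form (fun w => theta (beta w) a)) z (col_mx u v) = 0.
Proof.
move=> db dO pos d0 u0 v0.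
pose X : 'M[R[i]]_(n, n + n) := row_mx 0 1%:M.
have rowX b : row b X = ddx _ b by rewrite row_row_mx row0 row1.
have XT : X *m thetamx (beta z) = 1%:M.
  by rewrite mul_row_col mul0mx add0r mulmx1.
pose M : 'M[R[i]]_(n.+1, n + n) := col_mx u (setrow a v X).
have r0 : row ord0 M = u.
  by apply/rowP => l; rewrite !mxE; case: splitP => // q _; rewrite ord1.
have rS b : row (lift ord0 b) M = row b (setrow a v X).
  apply/rowP => l; rewrite !mxE; case: splitP => [[[]]//|q /= qE].
  by rewrite (_ : b = q) ?mxE //; apply/val_inj; case: qE.
have rowa : row (lift ord0 a) M = v by rewrite rS row_setrow.
have r'0 : row' ord0 M = setrow a v X.
  by apply/row_matrixP => b; rewrite (row_row' ord0 b) rS.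
(* For [b] different from [a] the vector d/dx_b occurs twice among the arguments. *)
have detX b : local_Omega beta z (setrow a (ddx _ b) (setrow a v X)) =
    (Vol (beta z))%:C%C * (b == a)%:R.
  rewrite /local_Omega wedge_theta !setrow_mul ddx_theta XT; congr (_ * _).
  have -> : setrow a (delta_mx 0 b) (setrow a (v *m thetamx (beta z)) 1%:M) =
      setrow a (delta_mx 0 b) 1%:M :> 'M[R[i]]_n.
    by apply/matrixP => p q; rewrite !mxE; case: eqP.
  have [->|ba] := eqVneq b a; first by rewrite -row1 setrow_id det1.
  apply: (determinant_alternate (i1 := a) (i2 := b)); first by rewrite eq_sym.
  by move=> q; rewrite !mxE eqxx (negPf ba) eq_sym.
have := d0 M.
rewrite (ext_d_local_Omega (i := ord0) db dO (erefl (lift ord0 a))) ?r0 ?rowa //.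
rewrite (bigD1 a) //= big1 => [|b /negPf ba]; last by rewrite r'0 detX ba !mulr0.
rewrite [_ + 0]addr0 r'0 detX eqxx mulr1 expr0 mul1r => /eqP.
rewrite mulf_eq0 => /orP[/eqP //|].
(* [Num.sqrt] is 0 on nonpositive reals, so the positivity of the determinant is what makes [Vol]
   nonzero. *)
rewrite /Vol -(rmorph0 (real_complex R)) => /eqP /complexI /eqP.
by rewrite invr_eq0 sqrtr_eq0 leNgt posdef_det_gt0.
Qed.

(** The remaining terms dg_a /\ theta_a of the derivative vanish on two vectors killed by
    theta_a. *)
Lemma ext_d_one_form_theta (R : realType) (n : nat)
    (beta : 'rV[R]_(n + n) -> 'M[R[i]]_n) (z : 'rV[R]_(n + n))
    (g : 'I_n -> 'rV[R]_(n + n) -> R[i])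
    (f : 'rV[R]_(n + n) -> 'cV[R[i]]_(n + n))
    (u v : 'rV[R[i]]_(n + n)) :
  (forall i j, cdifferentiable (fun w => beta w i j) z) ->
  (forall a, cdifferentiable (g a) z) ->
  (\forall w \near z, f w = \sum_a g a w *: theta (beta w) a) ->
  u *m thetamx (beta z) = 0 -> v *m thetamx (beta z) = 0 ->
  ext_d (one_form f) z (col_mx u v) =
  \sum_a g a z * ext_d (one_form (fun w => theta (beta w) a)) z (col_mx u v).
Proof.
move=> db dg fE u0 v0.
have half p (q : 'rV[R[i]]_(n + n)) : q *m thetamx (beta z) = 0 ->
    cderive p (fun w => (q *m f w) 0 0) z =
    \sum_a g a z * cderive p (fun w => (q *m theta (beta w) a) 0 0) z.
  move=> q0; rewrite (eq_near_cderive p (g := fun w =>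
      \sum_a (q *m theta (beta w) a) 0 0 * g a w)); last first.
    apply: filterS fE => w ->; rewrite mulmx_sumr summxE; apply: eq_bigr => a _.
    by rewrite -scalemxAr mxE mulrC.
  rewrite cderive_sum_zero //.
  - by apply: eq_bigr => a _; rewrite mulrC.
  - by move=> a; exact: (cdifferentiable_theta q a db).
  - by move=> a; rewrite mul_theta_row q0 mxE.
rewrite ext_d_one_form !half // -sumrB; apply: eq_bigr => a _.
by rewrite ext_d_one_form mulrBr.
Qed.

(** The coefficients are thus read off from the dx-components, and are smooth whenever the
    combination is. *)
Lemma sum_theta_rshift (K : comNzRingType) (n : nat) (beta : 'M[K]_n)
    (k : 'I_n -> K) (i : 'I_n) :
  (\sum_a k a *: theta beta a) (rshift n i) 0 = k i.
Proof.
rewrite summxE (bigD1 i) //= big1 => [|a ai].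
  by rewrite addr0 mxE -col_thetamx mxE col_mxEd mxE eqxx mulr1.
by rewrite mxE -col_thetamx mxE col_mxEd mxE eq_sym (negPf ai) mulr0.
Qed.

(** * From integrability and the F^2 condition to the vanishing of dOmega *)

(** Two [dy] factors need two non-vertical arguments, and only argument [i0] can be one. *)
Lemma wedge_dcoord_eq0 (K : comNzRingType) (n k : nat)
    (I : {ffun 'I_k -> 'I_(n + n)}) (M : 'M[K]_(k, n + n)) (i0 : 'I_k) :
  (2 <= count_dy I)%N -> (forall i, i != i0 -> lsubmx (row i M) = 0) ->
  wedge (fun l => dcoord K (I l)) M = 0.
Proof.
move=> /card_gt1P[l1 [l2 [I1 I2 l12]]] M0; rewrite /wedge.
set A := \matrix_(_, _) _.
have AE l j : A l j = M j (I l).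
  by rewrite mxE /dcoord -colE !mxE.
have A0 l j : (I l < n)%N -> j != i0 -> A l j = 0.
  move=> Il ji; rewrite AE.
  have := congr1 (fun x : 'rV_n => x 0 (Ordinal Il)) (M0 j ji).
  by rewrite !mxE => <-; congr (M _ _); apply/val_inj.
(* Rows [l1] and [l2] of [A] are both supported in column [i0]. *)
rewrite (expand_det_row A l1) big1 // => j _.
have [->|ji] := eqVneq j i0; last by rewrite A0 ?mul0r.
(* The minor omits column [i0], so its row [p], coming from row [l2], is zero. *)
have /unlift_some[p pE _] := l12.
suff -> : cofactor A l1 i0 = 0 by rewrite mulr0.
rewrite /cofactor (expand_det_row _ p) big1 ?mulr0 // => q _.
by rewrite 2!mxE -pE A0 ?mul0r // eq_sym neq_lift.
Qed.

(** By multilinearity every argument may be taken vertical or of type (0,1). Two non-vertical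
    arguments are then both of type (0,1), and dtheta vanishes on them; otherwise the F^2 expansion
    at [z] applies. *)
Lemma ext_d_local_Omega_eq0 (R : realType) (n : nat)
    (beta : 'rV[R]_(n + n) -> 'M[R[i]]_n) (z : 'rV[R]_(n + n)) :
  (forall i j, cdifferentiable (fun w => beta w i j) z) ->
  (forall N, cdifferentiable (fun w => local_Omega beta w N) z) ->
  (\forall w \near z, multilinear (local_Omega beta w)) ->
  (forall a (u v : 'rV[R[i]]_(n + n)),
     u *m thetamx (beta z) = 0 -> v *m thetamx (beta z) = 0 ->
     ext_d (one_form (fun w => theta (beta w) a)) z (col_mx u v) = 0) ->
  (exists g : {ffun 'I_n.+1 -> 'I_(n + n)} -> R[i], forall M,
     ext_d (local_Omega beta) z M =
     \sum_(I | (2 <= count_dy I)%N)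
        g I * wedge (fun l => dcoord R[i] (I l)) M) ->
  forall M, ext_d (local_Omega beta) z M = 0.
Proof.
move=> db dO mO dtheta [g F2].
apply: (multilinear_eq0
  (P := fun u => lsubmx u = 0 \/ u *m thetamx (beta z) = 0)).
- exact: multilinear_ext_d.
(* The vertical vector with x-components theta_a(u) has the same theta-values as [u], so the
   difference is killed by all theta_a. *)
- move=> u; exists (row_mx 0 (u *m thetamx (beta z))).
  exists (u - row_mx 0 (u *m thetamx (beta z))); split.
    by rewrite addrC subrK.
    by left; rewrite row_mxKl.
  by right; rewrite mulmxBl mul_row_col mul0mx add0r mulmx1 subrr.
move=> M pureM.
have [[i [i' [ii' yi yi']]]|one] := pselect (exists i i',
    [/\ i != i', lsubmx (row i M) <> 0 & lsubmx (row i' M) <> 0]).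
  have [//|Mi] := pureM i; have [//|Mi'] := pureM i'.
  have /unlift_some[j jE _] := ii'.
  rewrite (ext_d_local_Omega db dO (esym jE) Mi Mi') big1 // => a _.
  by rewrite dtheta ?mul0r.
(* [i0] is the non-vertical row if there is one, and arbitrary otherwise. *)
have [i0 M0] : exists i0, forall i, i != i0 -> lsubmx (row i M) = 0.
  have [[i0 y0]|all0] := pselect (exists i, lsubmx (row i M) <> 0).
    exists i0 => i ii0; apply: contrapT => yi; apply: one.
    by exists i0, i; rewrite eq_sym.
  by exists ord0 => i _; apply: contrapT => yi; apply: all0; exists i.
by rewrite F2 big1 // => I I2; rewrite (wedge_dcoord_eq0 (i0 := i0)) ?mulr0.
Qed.

(** * Smoothness of the theta_i, and the equivalence on the whole space *)

Lemma csmooth_theta (R : realType) (n : nat) (W : set 'rV[R]_(n + n))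
    (beta : 'rV[R]_(n + n) -> 'M[R[i]]_n) (a : 'I_n) (l : 'I_(n + n)) :
  open W -> (forall i j, csmooth W (fun z => beta z i j)) ->
  csmooth W (fun z => theta (beta z) a l 0).
Proof.
move=> oW sb.
have -> : (fun z => theta (beta z) a l 0) = (fun z => thetamx (beta z) l a).
  by apply/funext => z; rewrite -col_thetamx mxE.
case: (splitP l) => q qE.
  rewrite (_ : l = lshift n q); last exact/val_inj.
  by under eq_fun do rewrite col_mxEu mxE.
rewrite (_ : l = rshift n q); last exact/val_inj.
under eq_fun do rewrite col_mxEd.
exact: cst_csmooth.
Qed.

Theorem theorem5p10 (R : realType) (n : nat) (B : manifold R n)
    (Lam : lagrangian_family B) (beta : betas B)
    (beta_smooth : forall c i j, csmooth (phase c) (fun z => beta c z i j))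
    (beta_sym : forall c z, phase c z -> (beta c z)^T = beta c z)
    (beta_pos : forall c z, phase c z -> posdef (mx_Im (beta c z)))
    (Omega_form : is_form Lam (Omega beta))
    (J : endos B) (J_acs : almost_complex Lam J) (J_ind : induced_acs beta J) :
  form_zero (form_d (Omega beta)) <->
  integrable_acs J /\ in_filtration Lam 2 (form_d (Omega beta)).
Proof.
have [mO sO _] := Omega_form; have [JJ _ _] := J_acs.
have db c z : phase c z ->
    forall i j, cdifferentiable (fun w => beta c w i j) z.
  by move=> cz i j; apply: csmooth_differentiable cz.
have dO c z : phase c z ->
    forall N, cdifferentiable (fun w => local_Omega (beta c) w N) z.
  by move=> cz N; apply: csmooth_differentiable (sO c N) cz.
have ker c z v : phase c z ->
    vector01 (J c z) v <-> v *m thetamx (beta c z) = 0.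
  by move=> cz; apply: vector01P; [exact: JJ | exact: J_ind].
split=> [d0|[intJ [_ F2]]].
- split.
    move=> c W a oW Wc sa a10 z Wz u v; have cz := Wc _ Wz.
    move=> /(ker _ _ _ cz) u0 /(ker _ _ _ cz) v0.
    (* The (1,0)-form [a] is a combination of the theta_i whose coefficients, its dx-components,
       inherit smoothness from [a]. *)
    rewrite (ext_d_one_form_theta (g := fun i w => a w (rshift n i) 0) (db c z cz)) //.
    + rewrite big1 // => i _.
      rewrite (ext_d_theta_eq0 i (db c z cz) (dO c z cz) (beta_pos c z cz)) //.
        exact: mulr0.
      by move=> M; apply: d0.
    + by move=> i; apply: csmooth_differentiable (sa _) Wz.
    apply: filterS (open_nbhs_nbhs (conj oW Wz)) => w Ww.
    have [k kE] := (J_ind c w (Wc _ Ww) (a w)).1 (a10 w Ww).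
    by rewrite {1}kE; apply: eq_bigr => i _; rewrite kE sum_theta_rshift.
  split.
    split.
    + move=> c z cz; split=> [A B' C i b b' _ _ _|A i j _ _]; rewrite !(d0 c z) //.
      by rewrite !mulr0 addr0.
    + by move=> c M; apply: zero_csmooth => [|z]; [exact: phase_open | exact: d0].
    + move=> c c' W h [_ _ hW] z M Wz; have [cz cz' _ _] := hW z Wz.
      by rewrite /pullback !d0.
  move=> c z cz; exists (phase c), (fun _ _ => 0); split=> //.
  + by split=> //; apply: phase_open.
  + by move=> I; apply: zero_csmooth => //; exact: phase_open.
  move=> w M cw; rewrite d0 // big1 // => I _; exact: mul0r.
move=> c z M cz; apply: ext_d_local_Omega_eq0 (db c z cz) (dO c z cz) _ _ _ M.
- have nc : nbhs z (phase c).
    by apply: open_nbhs_nbhs; split; first exact: phase_open.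
  apply: filterS nc => w cw.
  by have [] := mO c w cw.
(* Integrability is applied to theta_a itself, a smooth (1,0)-form on all of [phase c]. *)
- move=> a u v /(ker _ _ _ cz) u0 /(ker _ _ _ cz) v0.
  apply: (intJ c (phase c)) => //; first exact: phase_open.
  + by move=> l; apply: csmooth_theta => //; apply: phase_open.
  by move=> w cw; apply/(J_ind c w cw)/theta_span.
have [W [g [[_ Wz] _ _ gE]]] := F2 c z cz.
by exists (fun I => g I z) => N; apply: gE.
Qed.
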